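(* Let $(X,d)$ be a nonempty compact metric space and let $\ell:X\times X\times\mathbb R^2\to\mathbb R$ be continuous and satisfy (l1)–(l4) of the context, with the critical constant of $\ell_0:=\ell(\cdot,\cdot,0,0)$ equal to $0$. Let $\lambda_0>0$ with $\lambda_0\max(\kappa_u,\kappa_v)<1$. Then for every $\lambda\in(0,\lambda_0)$ the operator $T_\lambda$ admits at least one fixed point $u_\lambda$. Moreover, the family of all such fixed points $u_\lambda$, for all $\lambda\in(0,\lambda_0)$, is uniformly bounded and equi-continuous.
   Context: Assumptions on $\ell=\ell(z,x,u,v)$: (l1) $\ell$ is $\kappa_u$-Lipschitz in $u$ and $\kappa_v$-Lipschitz in $v$, for constants $\kappa_u,\kappa_v\ge 0$; (l2) $\ell$ is non-increasing in $u$ and in $v$; (l3) $\partial_u\ell(z,x,0,0)$ and $\partial_v\ell(z,x,0,0)$ exist for all $(z,x)$, and for all $(z,x,u,v)$, $|\ell(z,x,u,v)-\ell(z,x,0,0)-\partial_u\ell(z,x,0,0)u-\partial_v\ell(z,x,0,0)v|\le\frac{|u|+|v|}{2}\,\eta\big(\frac{|u|+|v|}{2}\big)$, where $\eta:[0,\infty)\to[0,\infty)$ is a modulus of continuity (nondecreasing, $\eta(0)=0$, continuous at $0$); (l4) $\int_{X\times X}\big(\partial_u\ell(z,x,0,0)+\partial_v\ell(z,x,0,0)\big)d\mu(z,x)<0$ for all Mather measures $\mu$ of $\ell_0$. Critical constant: the unique $c_0\in\mathbb R$ for which there is a continuous $u:X\to\mathbb R$ with $u(x)=\min_{y\in X}\{u(y)+\ell_0(y,x)\}+c_0$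 for all $x$; here it is assumed that $c_0=0$. A Mather measure of $\ell_0$ is a Borel probability measure $\mu$ on $X\times X$ whose two marginals on $X$ coincide and with $\int_{X\times X}\ell_0\,d\mu=-c_0=0$. For $\lambda\in(0,\lambda_0)$ and $\varphi\in C^0(X,\mathbb R)$, $T_\lambda\varphi\in C^0(X,\mathbb R)$ is the unique continuous function with $T_\lambda\varphi(x)=\min_{z\in X}\{\varphi(z)+\ell(z,x,\lambda\varphi(z),\lambda T_\lambda\varphi(x))\}$ for all $x\in X$. *)

(* Defs.v *)
From HB Require Import structures.
From mathcomp Require Import all_boot all_order all_algebra.
From mathcomp Require Import all_classical all_reals all_analysis.
From mathcomp Require Import lra.

Set Implicit Arguments.
Unset Strict Implicit.
Unset Printing Implicit Defensive.

Import Order.TTheory GRing.Theory Num.Theory.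
Import numFieldNormedType.Exports.

Local Open Scope classical_set_scope.
Local Open Scope ring_scope.

(* The point only witnesses nonemptiness; [g_sigma_algebraType] below is a
   measurable type only over a pointed type. *)
#[short(type="pmetricType")]
HB.structure Definition PointedMetric (K : numDomainType) :=
  { M of Metric K M & Pointed M }.

Definition is_min (R : realType) (A : set R) (m : R) : Prop :=
  A m /\ lbound A m.

Definition modulus_of_continuity (R : realType) (eta : R -> R) : Prop :=
  [/\ forall r, 0 <= r -> 0 <= eta r,
      forall r s, 0 <= r -> r <= s -> eta r <= eta s,
      eta 0 = 0 &
      eta r @[r --> 0^'+] --> eta 0].

Definition du0 (R : realType) (X : Type) (l : X -> X -> R -> R -> R)
  (z x : X) : R := derive1 (fun u => l z x u 0) 0.

Definition dv0 (R : realType) (X : Type) (l : X -> X -> R -> R -> R)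
  (z x : X) : R := derive1 (fun v => l z x 0 v) 0.

Definition critical_constant (R : realType) (X : pmetricType R)
    (l0 : X -> X -> R) (c : R) : Prop :=
  exists u : continuousType X R,
    forall x, exists2 m, is_min (range (fun y => u y + l0 y x)) m & u x = m + c.

Lemma critical_constant_uniq (R : realType) (X : pmetricType R)
    (l0 : X -> X -> R) (c c' : R) : compact [set: X] ->
  critical_constant l0 c -> critical_constant l0 c' -> c = c'.
Proof.
move=> cX; wlog suff main : c c' / critical_constant l0 c ->
    critical_constant l0 c' -> c' <= c.
  by move=> h h'; apply/le_anti; rewrite (main c c') ?(main c' c).
move=> [u hu] [v hv].
have cuv : {within [set: X], continuous (fun x => u x - v x)}.
  apply: continuous_subspaceT => x; apply: cvgB; exact: cts_fun.
have [|x _ xmax] := compact_EVT_max _ cX cuv; first by exists point.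
have [m [_ lbm] ux] := hu x; have [_ [[y _ <-] _] vx] := hv x.
have uxy : m <= u y + l0 y x by apply: lbm; exists y.
have := xmax y (mem_set I); rewrite ux vx; lra.
Qed.

Section Mather.
Local Open Scope ereal_scope.

(* Borel sets of [X] and of [X * X] are generated by the open sets; the
   marginals of [mu] are its images under [fst] and [snd]. *)
Definition Mather_measure (R : realType) (X : pmetricType R)
    (l0 : X -> X -> R) (c : R)
    (mu : probability (g_sigma_algebraType (@open (X * X)%type)) R) : Prop :=
  (forall A : set X, <<s @open X >> A -> mu (fst @^-1` A) = mu (snd @^-1` A)) /\
  \int[mu]_p (l0 p.1 p.2)%:E = (- c)%:E.

End Mather.

Definition is_Tlam (R : realType) (X : pmetricType R)
    (l : X -> X -> R -> R -> R) (lam : R) (phi psi : continuousType X R) :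
    Prop :=
  forall x, is_min
    (range (fun z => phi z + l z x (lam * phi z) (lam * psi x))) (psi x).

(* The default value [cst 0] is returned only if no [psi] satisfies [is_Tlam]. *)
Definition Tlam (R : realType) (X : pmetricType R) (l : X -> X -> R -> R -> R)
    (lam : R) (phi : continuousType X R) : continuousType X R :=
  xget (cst 0 : continuousType X R) [set psi | is_Tlam l lam phi psi].

Definition fixed_points (R : realType) (X : pmetricType R)
    (l : X -> X -> R -> R -> R) (lam0 : R) : set (continuousType X R) :=
  [set u | exists2 lam, 0 < lam < lam0 & Tlam l lam u = u].

(* Main.v *)
Require Import Defs.
From HB Require Import structures.
From mathcomp Require Import all_boot all_order all_algebra.
From mathcomp Require Import all_classical all_reals all_analysis.
From mathcomp Require Import measurable_realfun ring lra.

(* Let [w] be a critical solution, [L y x = l0(y, x) + w y - w x >= 0] its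
   reduced cost and [f = du0 + dv0 <= 0]. By (l4) and compactness of the closed
   measures there are [K >= 0], [d > 0] and a bounded [phi] with
   [K L(y, x) - f(y, x) >= d + phi x - phi y]: otherwise some chains [x_0 .. x_n]
   have averages of [L] and [f] tending to [0], and a weak limit of their
   empirical measures is a Mather measure [mu] with [int f dmu = 0].
   For [A] large and [lam] small, [w - A + lam A phi] and [w + A - lam A phi]
   are then a strict sub- and supersolution of the fixed point equation, so
   they bound every fixed point, and Perron's method yields one between them.
   The fixed points inherit a modulus of continuity from [l]. *)

Set Implicit Arguments.
Unset Strict Implicit.
Unset Printing Implicit Defensive.

Import Order.TTheory GRing.Theory Num.Theory.
Import numFieldNormedType.Exports.

Local Open Scope classical_set_scope.
Local Open Scope ring_scope.

(** * Weak limits of empirical measures *)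

(** The obstacle is that [f] may vanish where [L] does: (l4) makes it negative only on average,
    while a strict subsolution needs a pointwise inequality. To first order, inserting
    [w - A + lam A phi] in the equation leaves [L y x - lam A f y x + lam A (phi y - phi x)], which
    the gap bounds below by [(1 - lam A K) L y x + lam A d]. Hence [lam A K <= 1] is required, and
    [lam A d] has to dominate the Taylor and Lipschitz errors. For the supersolution, one [y] with
    [L y x = 0] is enough at each [x]. The corrector [phi] is the infimum of a cost over the chains
    ending at a point, so the whole duality reduces to a lower bound on chain sums. A limit of
    averages along an ultrafilter is a priori only finitely additive; it is a measure for free on
    the clopen sets of a compact space, which is what brings in the Cantor space. Comparison and
    Perron's method treat arbitrary functions. They rest on [a + l z x (lam * a) b] being
    nondecreasing in [a], that is on [lam * ku <= 1]; continuity is recovered at the end. *)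

Definition clopen_algebra (T : ptopologicalType) : Type := T.

HB.instance Definition _ (T : ptopologicalType) :=
  Pointed.on (clopen_algebra T).

Fact clopen_display : measure_display. Proof. exact: default_measure_display. Qed.

HB.instance Definition _ (T : ptopologicalType) :=
  @isAlgebraOfSets.Build clopen_display (clopen_algebra T) (@clopen T)
    clopen0 clopenU (fun A => @clopenC _ A A).

(* By compactness a clopen countable union of clopen sets is a finite one, so
   additivity already gives sigma-additivity. *)
Lemma clopen_extension (R : realType) (T : ptopologicalType) (m : set T -> R) :
  compact [set: T] -> (forall A, 0 <= m A) ->
  (forall A B, clopen A -> clopen B -> A `&` B = set0 ->
    m (A `|` B) = m A + m B) ->
  m setT = 1 ->
  exists P : probability (g_sigma_algebraType (@clopen T)) R,
    forall A, clopen A -> P A = (m A)%:E.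
Proof.
move=> cT m_ge0 mU m1.
have m0 : m set0 = 0.
  by have := mU _ _ clopen0 clopen0 (setI0 _); rewrite setU0; lra.
pose mu : set (clopen_algebra T) -> \bar R := fun A => (m A)%:E.
have mu0 : mu set0 = 0%E by rewrite /mu m0.
have mu_ge0 A : (0 <= mu A)%E by rewrite lee_fin.
have mu_sigma : semi_sigma_additive mu.
  move=> F Fc tF UFc.
  have bigc n : clopen (\big[setU/set0]_(0 <= i < n) F i).
    elim: n => [|n ih]; first by rewrite big_geq//; exact: clopen0.
    by rewrite big_nat_recr//=; apply: clopenU => //; exact: Fc.
  have sumF n : (\sum_(0 <= i < n) mu (F i) =
      mu (\big[setU/set0]_(0 <= i < n) F i))%E.
    elim: n => [|n ih]; first by rewrite !big_geq.
    rewrite !big_nat_recr//= ih /mu -EFinD mU//; first exact: Fc.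
    rewrite big_mkord -subset0 => x [].
    rewrite -bigcup_mkord => -[j /= jn Fj] Fn.
    have /(_ j n) : trivIset setT F by [].
    by move=> /(_ I I (ex_intro _ x (conj Fj Fn))) jE; rewrite jE ltnn in jn.
  have cU : compact (\bigcup_n F n).
    apply: (@subclosed_compact _ _ setT) => //; exact: UFc.2.
  have [N _ HN] : \forall n \near \oo,
      \bigcup_n F n `<=` \big[setU/set0]_(0 <= i < n) F i.
    have /compact_near_coveringP := cU.
    move=> /(_ _ \oo (fun n x => (\big[setU/set0]_(0 <= i < n) F i) x)) /=.
    apply=> x [j _ Fjx].
    exists (F j, [set n | (j < n)%N]) => /=.
      split; last by exists j.+1.
      by apply: open_nbhs_nbhs; split => //; exact: (Fc j).1.
    by move=> [y n] [/= Fy jn]; rewrite big_mkord -bigcup_mkord; exists j.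
  apply: cvg_near_cst; exists N => // n /= /HN sub.
  rewrite sumF; apply: (congr1 mu); apply/seteqP; split => //.
  by rewrite big_mkord -bigcup_mkord => x [j _ Fj]; exists j.
pose muM : {measure set (clopen_algebra T) -> \bar R} :=
  HB.pack mu (isMeasure.Build _ _ _ mu mu0 mu_ge0 mu_sigma).
have extE A : clopen A -> measure_extension muM A = (m A)%:E.
  by move=> cA; rewrite /measure_extension measurable_mu_extE.
have P1 : measure_extension muM setT = 1%E by rewrite extE ?m1//; exact: clopenT.
pose I := g_sigma_algebraType (@measurable _ (clopen_algebra T)).
pose Q : {measure set I -> \bar R} := measure_extension muM.
pose P : probability I R :=
  HB.pack (Q : set I -> \bar R) (Measure.class Q)
    (Measure_isProbability.Build _ _ _ Q P1).
by exists P.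
Qed.

(** Compactness of a segment gives a cluster point; along an ultrafilter it is a limit, because a
    set whose preimage is not in [U] has a complement whose preimage is. *)
Lemma ultra_bounded_cvg (R : realType) (U : set_system nat) (UU : UltraFilter U)
  (a : nat -> R) (B : R) : (forall n, `|a n| <= B) -> cvg (a @ U).
Proof.
move=> aB.
have [|l [_ cl]] := @segment_compact R (- B) B (a @ U) _.
  apply: (@filterE _ U) => n /=; rewrite in_itv/=.
  by have := aB n; rewrite ler_norml.
apply/cvg_ex; exists l => A Al.
have [//|nA] := in_ultra_setVsetC (a @^-1` A) UU.
by have [x [/= nAx /nAx]] := cl (~` A) A nA Al.
Qed.

(** * Averages along finite samples *)

Definition average (R : realType) (T : Type) (n : nat) (p : nat -> T)
  (g : T -> R) : R := (\sum_(i < n) g (p i)) / n%:R.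

Lemma averageD (R : realType) (T : Type) n p (f g : T -> R) :
  average n p (fun x => f x + g x) = average n p f + average n p g.
Proof. by rewrite /average big_split/= mulrDl. Qed.

Lemma averageZ (R : realType) (T : Type) n p c (f : T -> R) :
  average n p (fun x => c * f x) = c * average n p f.
Proof. by rewrite /average -mulr_sumr mulrA. Qed.

Lemma le_average (R : realType) (T : Type) n p (f g : T -> R) :
  (forall x, f x <= g x) -> average n p f <= average n p g.
Proof. by move=> fg; rewrite ler_wpM2r ?invr_ge0// ler_sum. Qed.

Lemma average_cst (R : realType) (T : Type) n (p : nat -> T) (c : R) :
  (0 < n)%N -> average n p (cst c) = c.
Proof.
move=> n0; rewrite /average sumr_const card_ord -[c *+ n]mulr_natr mulfK//.
by rewrite pnatr_eq0 -lt0n.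
Qed.

Lemma average_norm_le (R : realType) (T : Type) n p (f g : T -> R) e :
  (0 < n)%N -> (forall x, `|f x - g x| <= e) ->
  `|average n p f - average n p g| <= e.
Proof.
move=> n0 fg; have fgx x : - e <= f x - g x <= e by rewrite -ler_norml.
have h1 : average n p f <= average n p (fun x => cst e x + g x).
  by apply: le_average => x /=; have := fgx x; lra.
have h2 : average n p g <= average n p (fun x => cst e x + f x).
  by apply: le_average => x /=; have := fgx x; lra.
by move: h1 h2; rewrite !averageD average_cst// ler_norml; lra.
Qed.

(** The sum collapses to two endpoint values while the length exceeds [k]. This serves twice: for
    the equality of the marginals in the limit, and for passing from [L] to [l0] under the
    averages. *)
Lemma average_telescope (R : realType) (X : Type) (x : nat -> nat -> X)
    (n : nat -> nat) (w : X -> R) (B : R) :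
  (forall k, k < n k)%N -> (forall y, `|w y| <= B) ->
  average (n k) (fun i => (x k i, x k i.+1)) (fun p => w p.1 - w p.2)
    @[k --> \oo] --> 0.
Proof.
move=> nk wB; have B0 : 0 <= B := le_trans (normr_ge0 _) (wB (x 0%N 0%N)).
apply/cvgrPdist_le => e e0.
have e'0 : 0 < e / (B + B + 1) by apply: divr_gt0 => //; lra.
have := near_infty_natSinv_lt (PosNum e'0); apply: filterS => k /= ke.
have n0 : (0 < n k)%N by apply: leq_ltn_trans (nk k).
have -> : average (n k) (fun i => (x k i, x k i.+1)) (fun p => w p.1 - w p.2) =
    (w (x k 0%N) - w (x k (n k))) / (n k)%:R.
  rewrite /average -(big_mkord xpredT (fun i => w (x k i) - w (x k i.+1))).
  rewrite -(opprB _ (w (x k 0%N))) -(telescope_sumr (w \o x k))// -sumrN.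
  by congr (_ / _); apply: eq_bigr => i _; rewrite opprB.
rewrite sub0r normrN normrM [`|_^-1|]ger0_norm ?invr_ge0//.
have h1 : `|w (x k 0%N) - w (x k (n k))| <= B + B + 1.
  by rewrite (le_trans (ler_normB _ _))// -[leLHS]addr0 lerD// lerD.
have h2 : (n k)%:R^-1 <= e / (B + B + 1).
  apply: le_trans (ltW ke); rewrite lef_pV2 ?posrE ?ltr0n// ler_nat.
  exact: nk.
apply: (le_trans (ler_pM _ _ h1 h2)) => //.
by rewrite mulrCA divff ?mulr1//; lra.
Qed.

(** The new value [c] overrides [h] on [D], so a finite clopen cover yields a step function without
    first being made disjoint. *)
Inductive clopen_step (R : realType) (T : topologicalType) : (T -> R) -> Prop :=
| clopen_step0 : clopen_step (cst 0)
| clopen_stepU (h : T -> R) (D : set T) (c : R) : clopen_step h -> clopen D ->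
    clopen_step (fun x => c * \1_D x + h x * \1_(~` D) x).

Lemma clopen_step_approx (R : realType) (T : ptopologicalType) (g : T -> R)
  (e : R) : compact [set: T] ->
  (forall (x : T) A, nbhs x A -> exists D : set T, [/\ clopen D, D x & D `<=` A]) ->
  continuous g -> 0 < e ->
  exists2 h, clopen_step h & forall x, `|g x - h x| <= e.
Proof.
move=> cT base cg e0.
have /choice[D DP] x : exists D, [/\ clopen D, D x &
    forall y, D y -> `|g y - g x| <= e].
  have gx : nbhs x [set y | `|g x - g y| < e].
    by have /cvgrPdist_lt := cg x; exact.
  have [D [cD Dx DA]] := base _ _ gx.
  by exists D; split=> // y /DA /= /ltW; rewrite distrC.
have := cT; rewrite compact_cover => /(_ T setT D) [].
- by move=> x _; have [[]] := DP x.
- by move=> x _; exists x => //; have [] := DP x.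
move=> s _ scov.
have [h hs hP] : exists2 h, clopen_step h & forall y,
    (exists2 x, x \in (finmap.enum_fset s) & D x y) -> `|g y - h y| <= e.
  elim: (finmap.enum_fset s) => [|x r [h hs hP]].
    by exists (cst 0); [exact: clopen_step0 | move=> y []].
  exists (fun y => g x * \1_(D x) y + h y * \1_(~` D x) y).
    by apply: clopen_stepU => //; have [] := DP x.
  move=> y [z]; rewrite !indicE in_setC.
  have [yD|yD] := boolP (y \in D x) => /=.
    by move=> _ _; rewrite mulr1 mulr0 addr0; have [_ _] := DP x; apply; exact/set_mem.
  rewrite inE => /predU1P[->|zr Dzy]; first by move/mem_set; rewrite (negbTE yD).
  by rewrite mulr0 add0r mulr1; apply: hP; exists z.
by exists h => // x; apply: hP; have [y ys Dy] := scov x I; exists y.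
Qed.

(* A weak limit point of the empirical measures of the finite samples [p k],
   taken along an ultrafilter, so that it is a limit on every set. *)
Lemma weak_limit (R : realType) (T : ptopologicalType) (n : nat -> nat)
    (p : nat -> nat -> T) : compact [set: T] ->
  (forall (x : T) A, nbhs x A -> exists D : set T, [/\ clopen D, D x & D `<=` A]) ->
  (forall k, 0 < n k)%N ->
  exists P : probability (g_sigma_algebraType (@clopen T)) R,
  forall (g : T -> R) a, continuous g ->
    average (n k) (p k) g @[k --> \oo] --> a ->
    P.-integrable setT (EFin \o g) /\ (\int[P]_x (g x)%:E = a%:E)%E.
Proof.
move=> cT base n0.
have [U [UU ooU]] := @ultraFilterLemma nat \oo _.
have ucvg (g : T -> R) B : (forall x, `|g x| <= B) ->
    cvg (average (n k) (p k) g @[k --> U]).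
  move=> gB; apply: (@ultra_bounded_cvg _ _ _ _ B) => k.
  rewrite -(subr0 (average _ _ _)) -(average_cst (p k) 0 (n0 k)).
  by apply: average_norm_le => // x; rewrite subr0.
(* The ultrafilter makes the limit exist for all sets at once, and finite additivity passes from the
   averages to the limit. *)
pose m (A : set T) : R := lim (average (n k) (p k) (\1_A : T -> R) @[k --> U]).
have indcvg (A : set T) :
    average (n k) (p k) (\1_A : T -> R) @[k --> U] --> m A.
  apply: (@ucvg _ 1) => x; rewrite indicE; case: (_ \in _) => /=;
    by rewrite ?normr1 ?normr0.
have m_ge0 A : 0 <= m A.
  apply: limr_ge; first exact: indcvg.
  apply: filterE => k; rewrite -(average_cst (p k) 0 (n0 k)).
  by apply: le_average => x; rewrite indicE.
have mU A B : clopen A -> clopen B -> A `&` B = set0 ->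
    m (A `|` B) = m A + m B.
  move=> _ _ AB; apply: (cvg_lim (@Rhausdorff R)).
  rewrite (_ : (fun k => average _ _ _) = fun k =>
    average (n k) (p k) (\1_A : T -> R) + average (n k) (p k) (\1_B : T -> R)).
    by apply: cvgD; exact: indcvg.
  apply/funext => k; rewrite -averageD; congr average; apply/funext => x.
  rewrite !indicE in_setU; case: (boolP (x \in A)) => xA;
    case: (boolP (x \in B)) => xB /=; rewrite ?addr0 ?add0r//.
  by have : (A `&` B) x; [split; exact: set_mem | rewrite AB].
have m1 : m setT = 1.
  apply: (cvg_lim (@Rhausdorff R)).
  rewrite (_ : (fun k => average _ _ _) = cst 1); first exact: cvg_cst.
  apply/funext => k; rewrite -[RHS](average_cst (p k) 1 (n0 k)).
  by congr average; apply/funext => x; rewrite indicT.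
have [P Pm] := clopen_extension cT m_ge0 mU m1.
exists P.
have mclopen A : clopen A ->
    measurable (A : set (g_sigma_algebraType (@clopen T))).
  by move=> cA; exact: sub_sigma_algebra.
have bint (g : T -> R) B : measurable_fun [set: g_sigma_algebraType (@clopen T)] g ->
    (forall x, `|g x| <= B) -> P.-integrable setT (EFin \o g).
  move=> mg gB; apply: measurable_bounded_integrable => //.
    by rewrite (le_lt_trans (probability_le1 P _)) ?ltry.
  exists B; split; first exact: num_real.
  by move=> M BM x _; exact: le_trans (gB x) (ltW BM).
(* This class is stable under linear combinations and contains the clopen indicators; uniform
   approximation then reaches the continuous functions. *)
pose good (g : T -> R) :=
  [/\ measurable_fun [set: g_sigma_algebraType (@clopen T)] g,
      exists B, forall x, `|g x| <= B &
      average (n k) (p k) g @[k --> U] --> \int[P]_x g x].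
have goodZ c g : good g -> good (fun x => c * g x).
  case=> mg [B gB] cg; split.
  - exact: measurable_funM.
  - by exists (`|c| * B) => x; rewrite normrM ler_wpM2l.
  - rewrite RintegralZl//; last exact: bint gB.
    under eq_fun do rewrite averageZ.
    exact: cvgMl_tmp.
have goodD f g : good f -> good g -> good (fun x => f x + g x).
  case=> mf [A fA] cf [mg [B gB] cg]; split.
  - exact: measurable_funD.
  - by exists (A + B) => x; rewrite (le_trans (ler_normD _ _))// lerD.
  - rewrite RintegralD//; [|exact: bint fA|exact: bint gB].
    under eq_fun do rewrite averageD.
    exact: cvgD.
have goodI A : clopen A -> good (\1_A).
  move=> cA; split.
  - by apply: measurable_indic; exact: mclopen.
  - by exists 1 => x; rewrite indicE; case: (_ \in _); rewrite ?normr1 ?normr0.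
  - rewrite /Rintegral integral_indic//; last exact: mclopen.
    by rewrite setIT; have := indcvg A; rewrite -[m A](congr1 fine (Pm A cA)).
(* The factor [\1_E] strengthens the induction, since [clopen_stepU] multiplies the earlier function
   by the indicator of the complement of [D]. *)
have good_step h : clopen_step h -> forall E, clopen E ->
    good (fun x => h x * \1_E x).
  elim=> [E cE|{}h D c _ ih cD E cE].
    rewrite (_ : (fun _ => _) = fun x => 0 * \1_E x :> R)//.
    by apply: goodZ; exact: goodI.
  rewrite (_ : (fun _ => _) = fun x =>
    c * \1_(D `&` E) x + h x * \1_(~` D `&` E) x).
    by apply: goodD; [apply/goodZ/goodI/clopenI|apply/ih/clopenI => //; exact: clopenC].
  by apply/funext => x; rewrite !indicI/=; ring.
have good_step1 h : clopen_step h -> good h.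
  move=> /good_step /(_ setT clopenT); congr good; apply/funext => x.
  by rewrite indicT mulr1.
move=> g a cg ag.
have approx := clopen_step_approx cT base cg.
have mg : measurable_fun [set: g_sigma_algebraType (@clopen T)] g.
  have /choice[h hP] i : exists h, clopen_step h /\
      forall x, `|g x - h x| <= i.+1%:R^-1.
    by have [|h] := approx i.+1%:R^-1; [rewrite invr_gt0|exists h].
  pose f : (g_sigma_algebraType (@clopen T) -> R)^nat := h.
  apply: (@measurable_fun_cvg _ _ _ _ f) => [i|x _].
    by have [/good_step1[]] := hP i.
  apply/cvgrPdist_le => e e0; near=> i.
  have [_ /(_ x) /le_trans] := hP i; apply.
  by apply: ltW; near: i; exact: near_infty_natSinv_lt (PosNum e0).
have [B gB] : exists B, forall x, `|g x| <= B.
  have [h /good_step1[_ [B hB] _] gh] := approx 1 ltr01.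
  exists (1 + B) => x; rewrite -(subrK (h x) (g x)).
  by rewrite (le_trans (ler_normD _ _))// lerD.
have ig := bint _ _ mg gB.
split=> //.
suff -> : a = \int[P]_x g x by rewrite /Rintegral fineK//; exact: integrable_fin_num.
(* [U] refines [\oo], so the assumed limit [a] is also the limit along [U]. *)
have -> : a = lim (average (n k) (p k) g @[k --> U]).
  apply/esym/(cvg_lim (@Rhausdorff R)).
  by apply: cvg_trans ag; exact: cvg_app.
apply: (cvg_lim (@Rhausdorff R)); apply/cvgrPdist_le => e e0.
have e3 : 0 < e / 3 by lra.
have [h /good_step1[mh [B' hB] ch] gh] := approx _ e3.
have ih := bint _ _ mh hB.
have Igh : `|\int[P]_x g x - \int[P]_x h x| <= e / 3.
  have icst (c : R) : P.-integrable setT (EFin \o cst c).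
    by apply: (bint _ `|c|) => //; exact: measurable_cst.
  have Icst (c : R) : \int[P]_x (cst c x) = c.
    rewrite Rintegral_cst// -[RHS]mulr1; congr (_ * _).
    by have := congr1 fine (probability_setT P).
  have ghx x : - (e / 3) <= g x - h x <= e / 3 by rewrite -ler_norml.
  have h1 : \int[P]_x g x <= \int[P]_x (cst (e / 3) x + h x).
    apply: le_Rintegral => //; last by move=> x _ /=; have := ghx x; lra.
    by apply: (bint _ (e / 3 + B')) => [|x /=]; [exact: measurable_funD|
       rewrite (le_trans (ler_normD _ _))// lerD// gtr0_norm].
  have h2 : \int[P]_x h x <= \int[P]_x (cst (e / 3) x + g x).
    apply: le_Rintegral => //; last by move=> x _ /=; have := ghx x; lra.
    by apply: (bint _ (e / 3 + B)) => [|x /=]; [exact: measurable_funD|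
       rewrite (le_trans (ler_normD _ _))// lerD// gtr0_norm].
  by move: h1 h2; rewrite !RintegralD// !Icst ler_norml; lra.
move/cvgrPdist_le : ch => /(_ _ e3); apply: filterS => k.
have := average_norm_le (p k) (n0 k) gh.
by move: Igh; rewrite !ler_norml; lra.
Unshelve. all: by end_near. Qed.

(** * Clopen sets of the Cantor space and of its square *)

Definition cylinder (n : nat) (t : cantor_space) : set cantor_space :=
  [set s | forall i, (i < n)%N -> s i = t i].

Lemma nbhs_cylinder n (t : cantor_space) : nbhs t (cylinder n t).
Proof.
elim: n => [|n ih]; first by apply: filterS filterT.
have pc : {for t, continuous (@proj nat (fun=> bool) n : cantor_space -> bool)}.
  exact: (@proj_continuous nat (fun=> bool) n).
have tn : nbhs t [set s : cantor_space | s n = t n].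
  apply: (pc [set b | b = t n]).
  by apply: open_nbhs_nbhs; split => //; exact: discrete_open.
apply: filterS (filterI ih tn) => s [sn sE] i.
by rewrite ltnS leq_eqVlt => /predU1P[->|/sn].
Qed.

(** The cylinders around [t] generate a filter, and it suffices that this filter converges to [t] in
    each coordinate: a cylinder of length [i.+1] already fixes coordinate [i]. *)
Lemma nbhs_cantorP (t : cantor_space) (U : set cantor_space) :
  nbhs t U -> exists n, cylinder n t `<=` U.
Proof.
pose F := filter_from [set: nat] (cylinder ^~ t).
have FF : Filter F.
  apply: filter_from_filter; first by exists 0%N.
  move=> i j _ _; exists (maxn i j) => // s st; split=> k ki; apply: st.
    by rewrite (leq_trans ki)// leq_maxl.
  by rewrite (leq_trans ki)// leq_maxr.
suff Ft : F --> t by move=> /Ft [n _ nU]; exists n.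
apply/cvg_sup => i.
have surj : (@proj nat (fun=> bool) i) @` setT = setT.
  by apply/seteqP; split=> // b _ /=; exists (fun=> b).
apply/cvg_image => // A /nbhs_singleton At.
exists ((@proj nat (fun=> bool) i) @^-1` A).
  by exists i.+1 => // s st; rewrite /preimage/= /proj st.
by rewrite image_preimage.
Qed.

(** The [n]-th set collects the points whose box of depth [n] lies in [U]. Membership depends on the
    first [n] coordinates only, so the set and its complement are both open. Open sets thereby
    belong to the sigma-algebra generated by the clopen ones. *)
Lemma open_cantor2_bigcup (U : set (cantor_space * cantor_space)) : open U ->
  exists2 F : (set (cantor_space * cantor_space))^nat,
    forall n, clopen (F n) & U = \bigcup_n F n.
Proof.
move=> oU.
pose cyl n t := cylinder n t.1 `*` cylinder n t.2.
have nbhs_cyl n t : nbhs t (cyl n t).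
  by exists (cylinder n t.1, cylinder n t.2) => //; split; exact: nbhs_cylinder.
have cyl_sym n s t : cyl n t s -> cyl n s t.
  by move=> [h1 h2]; split=> i ni; [rewrite h1|rewrite h2].
have cyl_tr n r s t : cyl n r s -> cyl n s t -> cyl n r t.
  by move=> [h1 h2] [h3 h4]; split=> i ni; [rewrite h3// h1|rewrite h4// h2].
have det_open n (A : set (cantor_space * cantor_space)) :
    (forall s t, cyl n s t -> A s -> A t) -> open A.
  move=> Adet; rewrite openE => t At; apply: filterS (nbhs_cyl n t) => s.
  by move=> st; exact: Adet st At.
exists (fun n => [set t | cyl n t `<=` U]) => [n|].
  have det s t : cyl n s t -> cyl n s `<=` U -> cyl n t `<=` U.
    by move=> st sU r tr; apply: sU; exact: cyl_tr tr.
  split; first exact: det_open det.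
  rewrite -openC; apply: (det_open n) => s t st nsU tU; apply: nsU.
  exact: det (cyl_sym _ _ _ st) tU.
apply/seteqP; split=> [t Ut|t [n _]]; last by apply; exact: nbhs_singleton.
have [[A B] /= [/nbhs_cantorP[i iA] /nbhs_cantorP[j jB]] AB] : nbhs t U.
  exact: open_nbhs_nbhs.
exists (maxn i j) => // s [h1 h2]; apply: AB; split => /=.
  by apply: iA => k ki; apply: h1; rewrite (leq_trans ki)// leq_maxl.
by apply: jB => k kj; apply: h2; rewrite (leq_trans kj)// leq_maxr.
Qed.

Lemma cantor2_compact : compact [set: cantor_space * cantor_space].
Proof.
have := compact_setX cantor_space_compact cantor_space_compact.
by congr compact; apply/seteqP; split.
Qed.

(* [X] is a continuous image of the Cantor space, so the chain is lifted there:
   on a zero-dimensional space weak limits only involve clopen sets. *)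
Lemma chain_weak_limit (R : realType) (X : pmetricType R)
    (x : nat -> nat -> X) (n : nat -> nat) : compact [set: X] ->
  (forall k, k < n k)%N ->
  exists P : probability (g_sigma_algebraType (@open (X * X)%type)) R,
    (forall A : set X, <<s @open X >> A ->
       P (fst @^-1` A) = P (snd @^-1` A)) /\
    forall (g : X * X -> R) a, continuous g ->
      average (n k) (fun i => (x k i, x k i.+1)) g @[k --> \oo] --> a ->
      (\int[P]_p (g p)%:E = a%:E)%E.
Proof.
move=> cX nk.
have [f cf] := cantor_surj cX (@metric_hausdorff _ X).
(* [s] is an arbitrary section of [f]: it only lifts sample points, while test functions are pulled
   back along the continuous [f]. *)
have /choice[s sK] y : exists c : cantor_space, f c = y.
  by have [c _ fc] := @surj _ _ _ _ f y I; exists c.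
pose CC : topologicalType := (cantor_space * cantor_space)%type.
pose T : ptopologicalType := HB.pack (CC : Type) (Topological.class CC)
  (isPointed.Build CC (point, point)).
have [||] := @weak_limit R T n (fun k i => (s (x k i), s (x k i.+1)))
  cantor2_compact.
- move=> t A At; have : open A° by exact: open_interior.
  move=> /open_cantor2_bigcup[F Fc FA].
  have [i _ Fi] : (\bigcup_i F i) t by rewrite -FA.
  exists (F i); split=> // u Fu; apply: (@interior_subset _ A).
  by rewrite FA; exists i.
- by move=> k; exact: leq_ltn_trans (nk k).
move=> P HP.
pose phi (t : g_sigma_algebraType (@clopen T)) :
  g_sigma_algebraType (@open (X * X)%type) := (f t.1, f t.2).
have cphi : continuous (phi : T -> X * X).
  move=> t; apply: cvg_pair => /=.
    by apply: (@cvg_comp _ _ _ fst f) ; [exact: cvg_fst|exact: cf].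
  by apply: (@cvg_comp _ _ _ snd f) ; [exact: cvg_snd|exact: cf].
have mopen (U : set T) : open U ->
    measurable (U : set (g_sigma_algebraType (@clopen T))).
  move=> /open_cantor2_bigcup[F Fc ->]; apply: bigcupT_measurable => i.
  exact: sub_sigma_algebra.
have mphi : measurable_fun setT phi.
  apply: (@measurability _ _ _ (g_sigma_algebraType (@open (X * X)%type)) _ _
    (@open (X * X)%type)) => //.
  move=> _ [U oU <-]; rewrite setTI; apply: mopen.
  by move/continuousP : cphi; apply.
pose phiM : {mfun g_sigma_algebraType (@clopen T) >->
    g_sigma_algebraType (@open (X * X)%type)} :=
  HB.pack phi (isMeasurableFun.Build _ _ _ _ phi mphi).
exists (distribution P phiM); split; last first.
  move=> g a cg ga.
  have cgphi : continuous (g \o phi : T -> R).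
    by move=> t; apply: continuous_comp; [exact: cphi|exact: cg].
  have [||igphi <-] := HP (g \o phi) a; first exact: cgphi.
    by rewrite (_ : (fun k => _) = fun k =>
      average (n k) (fun i => (x k i, x k i.+1)) g)//; apply/funext => k;
      rewrite /average; congr (_ / _); apply: eq_bigr => i _; rewrite /= /phi/= !sK.
  rewrite integral_distribution//.
  apply/measurable_EFinP.
  move=> mT; apply: (measurability _ (RGenOInfty.measurableE R)) => //.
  move=> _ [_ [r ->] <-]; rewrite setTI; apply: sub_sigma_algebra.
  by move/continuousP : cg; apply; rewrite set_itvoy; exact: open_gt.
pose C : measurableType _ := g_sigma_algebraType (@clopen cantor_space).
have mfst : measurable_fun setT (fst : g_sigma_algebraType (@clopen T) -> C).
  apply: (@measurability _ _ _ C _ _ (@clopen cantor_space)) => //.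
  move=> _ [U cU <-]; rewrite setTI; apply: sub_sigma_algebra.
  by apply: preimage_clopen cU _ => t; exact: cvg_fst.
have msnd : measurable_fun setT (snd : g_sigma_algebraType (@clopen T) -> C).
  apply: (@measurability _ _ _ C _ _ (@clopen cantor_space)) => //.
  move=> _ [U cU <-]; rewrite setTI; apply: sub_sigma_algebra.
  by apply: preimage_clopen cU _ => t; exact: cvg_snd.
pose fstM : {mfun g_sigma_algebraType (@clopen T) >-> C} :=
  HB.pack (fst : g_sigma_algebraType (@clopen T) -> C)
     (isMeasurableFun.Build _ _ _ _ _ mfst).
pose sndM : {mfun g_sigma_algebraType (@clopen T) >-> C} :=
  HB.pack (snd : g_sigma_algebraType (@clopen T) -> C)
     (isMeasurableFun.Build _ _ _ _ _ msnd).
(* The indicator of a clopen set is continuous, so the telescoping average computes the difference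
   of the two marginals. Uniqueness of measures on a pi-system extends the equality, and [f] carries
   it to [X]. *)
have clopen_marginals U : clopen U ->
    distribution P fstM U = distribution P sndM U.
  move=> cU; pose h (c : cantor_space) : R := \1_U c.
  have ch : continuous h.
    move=> c; have [cU'|cU'] := pselect (U c).
      apply: cvg_near_cst; have : nbhs c U.
        by apply: open_nbhs_nbhs; split => //; exact: cU.1.
      by apply: filterS => d dU; rewrite /h !indicE !mem_set.
    apply: cvg_near_cst; have : nbhs c (~` U).
      by apply: open_nbhs_nbhs; split => //; exact: (clopenC U cU).1.
    by apply: filterS => d dU; rewrite /h !indicE !memNset.
  pose g (t : T) : R := h t.1 - h t.2.
  have cg : continuous g.
    move=> t; apply: cvgB.
      by apply: (@cvg_comp _ _ _ fst h); [exact: cvg_fst|exact: ch].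
    by apply: (@cvg_comp _ _ _ snd h); [exact: cvg_snd|exact: ch].
  have [||_] := HP g 0; first exact: cg.
    apply: (@average_telescope _ _ (fun k => s \o x k) n h 1) => // c.
    by rewrite /h indicE; case: (_ \in _); rewrite ?normr1 ?normr0.
  have mU : measurable (U : set C) by exact: sub_sigma_algebra.
  have mU1 : measurable ((fst : T -> _) @^-1` U : set (g_sigma_algebraType (@clopen T))).
    by have := mfst measurableT U mU; rewrite setTI.
  have mU2 : measurable ((snd : T -> _) @^-1` U : set (g_sigma_algebraType (@clopen T))).
    by have := msnd measurableT U mU; rewrite setTI.
  have := integrable_indic P mU1; have := integrable_indic P mU2 => i2 i1.
  rewrite /g /h.
  under eq_integral do rewrite EFinB.
  rewrite integralB//= integral_indic// integral_indic// !setIT => /eqP.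
  rewrite sube_eq; last 2 first.
  - exact: fin_num_measure.
  - exact: fin_num_adde_defr.
  by rewrite add0e => /eqP.
have marginals U : <<s @clopen cantor_space >> U ->
    distribution P fstM U = distribution P sndM U.
  pose m1 : {measure set C -> \bar R} := distribution P fstM.
  pose m2 : {measure set C -> \bar R} := distribution P sndM.
  apply: (@g_sigma_algebra_measure_unique _ R C (@clopen cantor_space) _
    (fun=> setT) _ _ m1 m2) => //.
  - by move=> B; exact: sub_sigma_algebra.
  - by move=> _; exact: clopenT.
  - by rewrite bigcup_const.
  - exact: clopenI.
  - move=> _; apply: le_lt_trans (ltry 1).
    exact: (probability_le1 (distribution P fstM) measurableT).
have mf : measurable_fun setT (f : C -> g_sigma_algebraType (@open X)).
  apply: (@measurability _ _ _ (g_sigma_algebraType (@open X)) _ _ (@open X)) => //.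
  move=> _ [U oU <-]; rewrite setTI.
  have ofU : open ((f : cantor_space -> X) @^-1` U).
    by move/continuousP : cf; apply.
  (* An open set of the Cantor space is decomposed by lifting it to the square and slicing back
     along [t |-> (t, point)]. *)
  have : open ((fst : CC -> cantor_space) @^-1` (f @^-1` U)).
    have cfst : continuous (fst : CC -> cantor_space) by move=> t; exact: cvg_fst.
    by move/continuousP : cfst; apply.
  move=> /open_cantor2_bigcup[F cF FU].
  pose pt (t : cantor_space) : cantor_space * cantor_space := (t, point).
  have cpt : continuous pt.
    move=> t; rewrite /continuous_at /pt.
    apply: (@cvg_pair _ _ _ _ (nbhs t) (nbhs (point : cantor_space))).
      exact: cvg_id.
    exact: cvg_cst.
  rewrite (_ : _ @^-1` _ = \bigcup_i (pt @^-1` F i)).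
    apply: bigcupT_measurable => i; apply: sub_sigma_algebra.
    exact: preimage_clopen.
  by rewrite -preimage_bigcup -FU.
move=> A mA; have := marginals (f @^-1` A) _; apply.
by have := mf measurableT A mA; rewrite setTI.
Qed.

(** * The gap given by the Mather measures *)

(** [phi z] is the infimum of the sums over all chains ending at [z]: the empty chain gives
    [phi z <= 0], and appending one step to a chain gives the inequality. *)
Lemma chain_potential (R : realType) (X : Type) (c : X -> X -> R) (B : R) :
  (forall (x : nat -> X) n, - B <= \sum_(i < n) c (x i) (x i.+1)) ->
  exists phi : X -> R, (forall x, - B <= phi x <= 0) /\
    forall y x, phi x <= phi y + c y x.
Proof.
move=> cB.
pose S z : set R := [set s | exists x n, x n = z /\
  s = \sum_(i < n) c (x i) (x i.+1)].
have S0 z : S z 0 by exists (fun=> z), 0%N; rewrite big_ord0.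
have Slb z : lbound (S z) (- B) by move=> _ [x [n [_ ->]]].
have Sinf z : has_lbound (S z) by exists (- B).
exists (fun z => inf (S z)); split=> [z|y z].
  apply/andP; split; last exact: ge_inf.
  by apply: lb_le_inf => //; exists 0.
rewrite -lerBlDr; apply: lb_le_inf; first by exists 0.
move=> _ [x [n [xn ->]]]; rewrite lerBlDr; apply: ge_inf => //.
exists (fun i => if (i <= n)%N then x i else z), n.+1; split.
  by rewrite ltnn.
rewrite big_ord_recr/= leqnn ltnn xn; congr (_ + _).
by apply: eq_bigr => i _; rewrite (ltnW (ltn_ord i)) ltn_ord.
Qed.

Lemma Mather_gap (R : realType) (X : pmetricType R) (l0 f : X -> X -> R)
    (w : X -> R) (W : R) : compact [set: X] ->
  continuous (fun p : X * X => l0 p.1 p.2) ->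
  continuous (fun p : X * X => f p.1 p.2) ->
  (forall x, `|w x| <= W) ->
  (forall y x, w x <= w y + l0 y x) ->
  (forall y x, f y x <= 0) ->
  (forall mu : probability (g_sigma_algebraType (@open (X * X)%type)) R,
     Mather_measure l0 0 mu -> (\int[mu]_p (f p.1 p.2)%:E < 0)%E) ->
  exists K d C, exists phi : X -> R, [/\ 0 <= K, 0 < d,
    forall x, - C <= phi x <= 0 &
    forall y x, d + phi x - phi y <= K * (l0 y x + w y - w x) - f y x].
Proof.
move=> cX cl0 cf wW wl0 f_le0 HM.
pose L y x := l0 y x + w y - w x.
have L0 y x : 0 <= L y x by have := wl0 y x; rewrite /L; lra.
(* One index provides both constants, [K = k + 1] and [d = 1 / (k + 1)]. The only negative part of a
   chain sum is [- n / (k + 1)], so a sum below [- 1] forces [n > k + 1]: bad chains are long. *)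
pose c k y x : R := k.+1%:R * L y x - f y x - k.+1%:R^-1.
have [[k ck]|noc] := pselect (exists k, forall (x : nat -> X) n,
    - 1 <= \sum_(i < n) c k (x i) (x i.+1)).
  have [phi [phi1 phic]] := chain_potential ck.
  exists k.+1%:R, k.+1%:R^-1, 1, phi; split=> //.
  move=> y x; have := phic y x; rewrite /c -/(L y x).
  by move: k.+1%:R^-1 (_ * _) => ki kL; lra.
exfalso.
have /choice[xn xnP] k : exists xn : (nat -> X) * nat,
    \sum_(i < xn.2) c k (xn.1 i) (xn.1 i.+1) < - 1.
  apply: contrapT => no; apply: noc; exists k => x n; rewrite leNgt.
  by apply/negP => h; apply: no; exists (x, n).
pose x k := (xn k).1; pose n k := (xn k).2.
pose A k (g : X * X -> R) := average (n k) (fun i => (x k i, x k i.+1)) g.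
have sumE k : \sum_(i < n k) c k (x k i) (x k i.+1) =
    k.+1%:R * \sum_(i < n k) L (x k i) (x k i.+1)
    - \sum_(i < n k) f (x k i) (x k i.+1) - (n k)%:R / k.+1%:R.
  rewrite sumrB sumrB mulr_sumr; congr (_ - _).
  by rewrite sumr_const card_ord -[_ *+ n k]mulr_natl.
have sL0 k : 0 <= \sum_(i < n k) L (x k i) (x k i.+1) by apply: sumr_ge0.
have sf0 k : \sum_(i < n k) f (x k i) (x k i.+1) <= 0.
  by apply: sumr_le0 => i _; exact: f_le0.
have k0 k : (0 : R) < k.+1%:R by [].
have ksL k : \sum_(i < n k) L (x k i) (x k i.+1) <=
    k.+1%:R * \sum_(i < n k) L (x k i) (x k i.+1).
  by rewrite ler_peMl// ler1n.
have nk k : (k < n k)%N.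
  have := xnP k; rewrite sumE -/(n k) -/(x k) => h.
  have : 1 < (n k)%:R / k.+1%:R :> R.
    have := ksL k; have := sL0 k; have := sf0 k; move: h.
    by move: (_ / _) (_ * _) => a b; lra.
  by rewrite ltr_pdivlMr// mul1r ltr_nat => /ltnW.
have n0 k : (0 : R) < (n k)%:R by rewrite ltr0n (leq_ltn_trans _ (nk k)).
have hk e : 0 < e -> \forall k \near \oo, k.+1%:R^-1 <= e :> R.
  move=> e0; have := near_infty_natSinv_lt (PosNum e0).
  by apply: filterS => k /ltW.
(* Along the bad chains [(k + 1) L] and [- f] are nonnegative and their averages add up to less than
   [1 / (k + 1)], so [L] and [f] can be treated separately. *)
have squeeze (g : X * X -> R) : (forall k, 0 <= A k g <= k.+1%:R^-1) ->
    A k g @[k --> \oo] --> 0.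
  move=> Ag; apply/cvgrPdist_le => e /hk; apply: filterS => k ke.
  have /andP[g0 gk] := Ag k.
  by rewrite sub0r normrN ger0_norm// (le_trans gk).
have AL : A k (fun p => L p.1 p.2) @[k --> \oo] --> 0.
  apply: squeeze => k; rewrite /A /average/= divr_ge0 ?sL0//=.
  rewrite ler_pdivrMr// mulrC.
  have := xnP k; rewrite sumE -/(n k) -/(x k).
  have := ksL k; have := sL0 k; have := sf0 k.
  by move: (_ / _) (k.+1%:R * _) => a b; lra.
have Af : A k (fun p => - 1 * f p.1 p.2) @[k --> \oo] --> 0.
  apply: (squeeze (fun p => - 1 * f p.1 p.2)) => k.
  rewrite /A averageZ /average/= mulN1r -mulNr.
  rewrite divr_ge0 ?oppr_ge0 ?sf0//=.
  rewrite ler_pdivrMr// mulrC.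
  have := xnP k; rewrite sumE -/(n k) -/(x k).
  have := ksL k; have := sL0 k; have := sf0 k.
  by move: (_ / _) (k.+1%:R * _) => a b; lra.
have [P [Pm PI]] := chain_weak_limit x cX nk.
have IL0 : (\int[P]_p (l0 p.1 p.2)%:E = 0)%E.
  apply: PI => //; rewrite -(subr0 0).
  rewrite (_ : (fun k => _) = fun k => A k (fun p => L p.1 p.2) -
    A k (fun p => w p.1 - w p.2)).
    by apply: cvgB => //; exact: average_telescope wW.
  apply/funext => k; apply/eqP; rewrite -subr_eq opprK; apply/eqP.
  by rewrite -averageD; congr average; apply/funext => p; rewrite /L; ring.
have If0 : (\int[P]_p (f p.1 p.2)%:E = 0)%E.
  apply: PI => //.
  rewrite (_ : (fun k => _) = fun k => - A k (fun p => -1 * f p.1 p.2)).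
    by rewrite -oppr0; exact: cvgN.
  by apply/funext => k; rewrite /A averageZ mulN1r opprK.
have : Mather_measure l0 0 P by split; rewrite ?oppr0.
by move/HM; rewrite If0 ltxx.
Qed.

(** * Perron's method and comparison *)

(* Here and below [G z x a b] stands for [a + l z x (lam * a) (lam * b)]. *)
Lemma Perron (R : realType) (X : Type) (G : X -> X -> R -> R -> R) (k : R)
    (v V : X -> R) : 0 <= k ->
  (forall z x a a' b, a <= a' -> G z x a b <= G z x a' b) ->
  (forall z x a b b', b <= b' -> G z x a b' <= G z x a b) ->
  (forall z x a b b', `|G z x a b - G z x a b'| <= k * `|b - b'|) ->
  (forall x, v x <= V x) ->
  (forall z x, v x <= G z x (v z) (v x)) ->
  (forall x, exists z, G z x (V z) (V x) < V x) ->
  exists u : X -> R, [/\ forall x, v x <= u x <= V x,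
    forall z x, u x <= G z x (u z) (u x) &
    forall x e, 0 < e -> exists z, G z x (u z) (u x) < u x + e].
Proof.
move=> k0 Gl Gr GL vV vsub Vsup.
pose S : set (X -> R) := [set s | (forall x, v x <= s x <= V x) /\
  forall z x, s x <= G z x (s z) (s x)].
pose Sx x : set R := [set s x | s in S].
have Sv : S v by split=> // x; rewrite lexx vV.
have Sub x : has_ubound (Sx x).
  by exists (V x) => _ [s [/(_ x) /andP[_ sV] _] <-].
pose u x := sup (Sx x).
have su s x : S s -> s x <= u x by move=> Ss; apply: ub_le_sup => //; exists s.
have uV x : u x <= V x.
  by apply: ge_sup; [exists (v x), v|move=> _ [s [/(_ x) /andP[_ sV] _] <-]].
have usub z x : u x <= G z x (u z) (u x).
  apply/ler_addgt0Pr => e e0.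
  (* Missing the supremum by [e / (1 + k)] costs that amount on the left and [k] times as much on
     the right, [e] in total. *)
  have d0 : 0 < e / (1 + k) by apply: divr_gt0 => //; lra.
  have [|_ [s Ss <-] su'] := @sup_adherent _ (Sx x) _ d0.
    by split => //; exists (v x), v.
  have := Ss.2 z x; have := Gl z x (s z) (u z) (s x) (su _ _ Ss).
  have := GL z x (u z) (s x) (u x); have := su _ x Ss.
  rewrite -/(u x) in su' * => sux; rewrite (ler0_norm (_ : s x - u x <= 0)) ?subr_le0//.
  have : k * - (s x - u x) <= k * (e / (1 + k)) by rewrite ler_wpM2l//; lra.
  have -> : k * (e / (1 + k)) = e - e / (1 + k) by field; lra.
  rewrite ler_norml.
  move: su'; move: (e / _) (k * _) => d kd; lra.
exists u; split=> // [x|x e e0]; first by rewrite uV (su v).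
(* Otherwise raising [u] at [x] alone gives a larger subsolution: monotonicity in [a] covers the
   steps leaving [x], and the slack [e] pays for those arriving at [x]. *)
apply: contrapT => noz.
have ge z : u x + e <= G z x (u z) (u x).
  by rewrite leNgt; apply/negP => h; apply: noz; exists z.
(* Room below [V] comes from its strictness: if [u x = V x], the strict step of [V] at [x] would be
   one of [u] too. *)
have uVx : u x < V x.
  rewrite lt_neqAle uV andbT; apply/eqP => uVx.
  have [z zV] := Vsup x; have := ge z; have := Gl z x _ _ (u x) (uV z).
  by move: zV; rewrite -uVx; lra.
pose d := Num.min (V x - u x) (e / (1 + k)).
have d0 : 0 < d by rewrite lt_min subr_gt0 uVx divr_gt0//; lra.
have dV : u x + d <= V x by rewrite -lerBrDl ge_min lexx.
have dk : d + k * d <= e.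
  have : d <= e / (1 + k) by rewrite ge_min lexx orbT.
  by rewrite ler_pdivlMr; [rewrite mulrDr mulr1 (mulrC k)|lra].
pose s y := if `[< y = x >] then u x + d else u y.
have us y : u y <= s y by rewrite /s; case: asboolP => [->|_]//; lra.
have sx : s x = u x + d by rewrite /s asboolT.
have Ss : S s.
  split=> [y|z y].
    rewrite (le_trans (su v _ Sv) (us y))/= /s.
    by case: asboolP => [->|_].
  apply: (@le_trans _ _ (G z y (u z) (s y))); last exact: Gl.
  have [->|yx] := pselect (y = x); last by rewrite /s [`[< y = x >]]asboolF.
  have := ge z; have := GL z x (u z) (u x + d) (u x); rewrite sx.
  by rewrite [_ + d]addrC addrK (gtr0_norm d0) ler_norml => ? ?; lra.
by have := su s x Ss; rewrite sx; lra.
Qed.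

(** Each round lowers the bound by [d], so more than [|t| / d] rounds bring it to 0. This replaces
    the evaluation at a maximum point and needs no topology. *)
Lemma upper_bound_descent (R : realType) (X : Type) (f : X -> R) (d t : R) :
  0 < d -> (forall x, f x <= t) ->
  (forall m, 0 <= m -> (forall x, f x <= m) ->
    forall x, f x <= Num.max (m - d) 0) ->
  forall x, f x <= 0.
Proof.
move=> d0 ft step.
have iter n x : f x <= Num.max (t - n%:R * d) 0.
  elim: n x => [|n ih] x; first by rewrite mul0r subr0 le_max ft.
  have m0 : 0 <= Num.max (t - n%:R * d) 0.
    by rewrite le_max lexx orbT.
  apply: (le_trans (step _ m0 ih x)).
  rewrite ge_max; apply/andP; split; last by rewrite le_max lexx orbT.
  rewrite -natr1 mulrDl mul1r le_max; move: (n%:R * d) => nd.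
  by case: (leP (t - nd) 0) => ?; apply/orP; [right|left]; lra.
have [n tn] : exists n, t - n%:R * d <= 0.
  exists (Num.trunc (`|t| / d)).+1; rewrite subr_le0 -ler_pdivrMr//.
  apply: (@le_trans _ _ (`|t| / d)); last exact/ltW/truncnS_gt.
  by rewrite ler_pM2r ?invr_gt0// ler_norm.
by move=> x; rewrite (le_trans (iter n x))// max_r.
Qed.

(** Let [v - u <= m] and [u x < v x], and take the step [z] of [u] at [x]. Lowering [v z] by [m]
    costs at most [m], and monotonicity then replaces [v z - m] by [u z] and [v x] by [u x]; thus
    [v x + d <= u x + m], which improves [m] by [d]. *)
Lemma strict_subsolution_le (R : realType) (X : Type)
    (G : X -> X -> R -> R -> R) (u v : X -> R) (d t : R) : 0 < d ->
  (forall z x a a' b, a <= a' -> G z x a b <= G z x a' b) ->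
  (forall z x a b b', b <= b' -> G z x a b' <= G z x a b) ->
  (forall z x a a' b, a <= a' -> G z x a' b <= G z x a b + (a' - a)) ->
  (forall z x, v x + d <= G z x (v z) (v x)) ->
  (forall x, exists z, G z x (u z) (u x) <= u x) ->
  (forall x, v x - u x <= t) -> forall x, v x <= u x.
Proof.
move=> d0 Gl Gr Gs vsub usup vut x; rewrite -subr_le0; move: x.
apply: (upper_bound_descent d0 vut) => m m0 vum x; rewrite le_max orbC.
have [vu|uv] := leP (v x) (u x); first by rewrite subr_le0 vu.
have [z uz] := usup x; have vumz := vum z.
have vm_u : v z - m <= u z by lra.
have vm_v : v z - m <= v z by lra.
have := Gr z x (u z) _ _ (ltW uv); have := Gl z x _ _ (v x) vm_u.
have := Gs z x _ _ (v x) vm_v; have := vsub z x => ? ? ? ?.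
by apply/orP; right; lra.
Qed.

(** The same descent, with the step [z] now supplied by [V]. *)
Lemma strict_supersolution_ge (R : realType) (X : Type)
    (G : X -> X -> R -> R -> R) (u V : X -> R) (d t : R) : 0 < d ->
  (forall z x a a' b, a <= a' -> G z x a b <= G z x a' b) ->
  (forall z x a b b', b <= b' -> G z x a b' <= G z x a b) ->
  (forall z x a a' b, a <= a' -> G z x a' b <= G z x a b + (a' - a)) ->
  (forall x, exists z, G z x (V z) (V x) + d <= V x) ->
  (forall z x, u x <= G z x (u z) (u x)) ->
  (forall x, u x - V x <= t) -> forall x, u x <= V x.
Proof.
move=> d0 Gl Gr Gs Vsup usub uVt x; rewrite -subr_le0; move: x.
apply: (upper_bound_descent d0 uVt) => m m0 uVm x; rewrite le_max orbC.
have [uV|Vu] := leP (u x) (V x); first by rewrite subr_le0 uV.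
have [z Vz] := Vsup x; have uVmz := uVm z.
have u_Vm : u z <= V z + m by lra.
have V_Vm : V z <= V z + m by lra.
have := Gr z x (u z) _ _ (ltW Vu); have := Gl z x _ _ (V x) u_Vm.
have := Gs z x _ _ (V x) V_Vm; have := usub z x => ? ? ? ?.
by apply/orP; right; lra.
Qed.

(** * The nonlinear cost *)

Lemma lipschitzE (R : realType) (k : R) (f : R -> R) : k.-lipschitz f ->
  forall a b, `|f a - f b| <= k * `|a - b|.
Proof. by move=> kf a b; exact: (kf (a, b) (conj I I)). Qed.

Lemma modulus_small (R : realType) (eta : R -> R) (e : R) :
  modulus_of_continuity eta -> 0 < e -> exists2 r, 0 < r & eta r <= e.
Proof.
move=> [eta_ge0 _ eta0 cveta] e0.
have : \forall r \near 0^'+, 0 < r /\ eta r <= e.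
  near=> r; split; first by near: r; exact: nbhs_right_gt.
  have : `|eta 0 - eta r| < e by near: r; move/cvgrPdist_lt : cveta; apply.
  by rewrite eta0 sub0r normrN => /ltW; apply: le_trans; exact: ler_norm.
by move=> /filter_ex[r [r0 re]]; exists r.
Unshelve. all: by end_near. Qed.

Lemma cost_equicontinuous (R : realType) (X : pmetricType R)
    (l : X -> X -> R -> R -> R) (M : R) (x : X) (e : R) : compact [set: X] ->
  continuous (fun p : (X * X) * (R * R) => l p.1.1 p.1.2 p.2.1 p.2.2) ->
  0 < e -> \forall x' \near x, forall z a b, `|a| <= M -> `|b| <= M ->
    `|l z x a b - l z x' a b| <= e.
Proof.
move=> cX cl e0.
pose I : set R := `[- M, M]%classic.
have cK : compact ([set: X] `*` (I `*` I)).
  by apply: compact_setX => //; apply: compact_setX; exact: segment_compact.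
have /compact_near_coveringP/(_ X (nbhs x)
  (fun x' q => `|l q.1 x q.2.1 q.2.2 - l q.1 x' q.2.1 q.2.2| <= e)) := cK.
move=> h; have : \forall x' \near x, [set: X] `*` (I `*` I) `<=`
    (fun q => `|l q.1 x q.2.1 q.2.2 - l q.1 x' q.2.1 q.2.2| <= e).
  apply: h => q _ /=.
  pose g1 (t : (X * (R * R)) * X) := l t.1.1 x t.1.2.1 t.1.2.2.
  pose g2 (t : (X * (R * R)) * X) := l t.1.1 t.2 t.1.2.1 t.1.2.2.
  have c11 : t.1.1 @[t --> (q, x)] --> q.1.
    by apply: (@cvg_comp _ _ _ fst fst); [exact: cvg_fst|exact: cvg_fst].
  have c12 : t.1.2 @[t --> (q, x)] --> q.2.
    by apply: (@cvg_comp _ _ _ fst snd); [exact: cvg_fst|exact: cvg_snd].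
  have c2 : t.2 @[t --> (q, x)] --> x by exact: cvg_snd.
  have cg1 : g1 t @[t --> (q, x)] --> l q.1 x q.2.1 q.2.2.
    apply: (@cvg_comp _ _ _ (fun t : (X * (R * R)) * X => ((t.1.1, x), t.1.2))
      _ _ (nbhs ((q.1, x), q.2)) _ _ (cl ((q.1, x), q.2))).
    apply: (@cvg_pair _ _ _ _ (nbhs (q.1, x)) (nbhs q.2)); last exact: c12.
    apply: (@cvg_pair _ _ _ _ (nbhs q.1) (nbhs x)); first exact: c11.
    exact: cvg_cst.
  have cg2 : g2 t @[t --> (q, x)] --> l q.1 x q.2.1 q.2.2.
    apply: (@cvg_comp _ _ _ (fun t : (X * (R * R)) * X => ((t.1.1, t.2), t.1.2))
      _ _ (nbhs ((q.1, x), q.2)) _ _ (cl ((q.1, x), q.2))).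
    apply: (@cvg_pair _ _ _ _ (nbhs (q.1, x)) (nbhs q.2)); last exact: c12.
    exact: (@cvg_pair _ _ _ _ (nbhs q.1) (nbhs x)).
  have : g1 t - g2 t @[t --> (q, x)] --> (0 : R).
    by rewrite -(subrr (l q.1 x q.2.1 q.2.2)); exact: cvgB.
  move=> /cvgrPdist_le/(_ _ e0).
  by apply: filterS => t; rewrite sub0r normrN.
apply: filterS => x' hx' z a b aM bM.
apply: (hx' (z, (a, b))); split=> //.
by split; rewrite /I/= in_itv/= -ler_norml.
Qed.

Lemma cost_Taylor (R : realType) (X : pmetricType R)
    (l : X -> X -> R -> R -> R) (eta : R -> R) :
  (forall z x u v,
     `|l z x u v - l z x 0 0 - du0 l z x * u - dv0 l z x * v|
       <= (`|u| + `|v|) / 2 * eta ((`|u| + `|v|) / 2)) ->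
  forall z x s, `|l z x s s - l z x 0 0 - (du0 l z x + dv0 l z x) * s|
    <= `|s| * eta `|s|.
Proof.
move=> l3 z x s; have := l3 z x s s.
have -> : (`|s| + `|s|) / 2 = `|s| by lra.
by rewrite mulrDl opprD addrA.
Qed.

Lemma cost_diagonal_continuous (R : realType) (X : pmetricType R)
    (l : X -> X -> R -> R -> R) (s : R) :
  continuous (fun p : (X * X) * (R * R) => l p.1.1 p.1.2 p.2.1 p.2.2) ->
  continuous (fun q : X * X => l q.1 q.2 s s).
Proof.
move=> cl p; apply: (@cvg_comp _ _ _ (fun q : X * X => (q, (s, s)))
  _ _ (nbhs (p, (s, s))) _ _ (cl (p, (s, s)))).
apply: (@cvg_pair _ _ _ _ (nbhs p) (nbhs (s, s))); first exact: cvg_id.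
exact: cvg_cst.
Qed.

(** The difference quotients at [r] are continuous and within [eta r] of [f], uniformly in both
    points. Continuity is what allows [f] to be integrated against the weak limit. *)
Lemma cost_slope_continuous (R : realType) (X : pmetricType R)
    (l : X -> X -> R -> R -> R) (f : X -> X -> R) (eta : R -> R) :
  continuous (fun p : (X * X) * (R * R) => l p.1.1 p.1.2 p.2.1 p.2.2) ->
  modulus_of_continuity eta ->
  (forall z x s, `|l z x s s - l z x 0 0 - f z x * s| <= `|s| * eta `|s|) ->
  continuous (fun p : X * X => f p.1 p.2).
Proof.
move=> cl eta_mod lf p.
apply/cvgrPdist_le => e e0.
have e3 : 0 < e / 3 by lra.
have [r r0 re] := modulus_small eta_mod e3.
have fr (q : X * X) : `|r^-1 * (l q.1 q.2 r r - l q.1 q.2 0 0) - f q.1 q.2| <= e / 3.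
  rewrite (le_trans _ re)//; have := lf q.1 q.2 r.
  rewrite (gtr0_norm r0) => h.
  rewrite -(ler_pM2l r0) -{1}(gtr0_norm r0) -normrM mulrBr mulrA.
  by rewrite divff ?gt_eqF// mul1r (mulrC r (f _ _)).
have : r^-1 * (l q.1 q.2 r r - l q.1 q.2 0 0) @[q --> p] -->
    r^-1 * (l p.1 p.2 r r - l p.1 p.2 0 0).
  by apply: cvgMl_tmp; apply: cvgB; exact: cost_diagonal_continuous.
move=> /cvgrPdist_le/(_ _ e3); apply: filterS => q; have := fr p; have := fr q.
by rewrite !ler_norml; lra.
Qed.

Lemma cost_slope_le0 (R : realType) (X : Type)
    (l : X -> X -> R -> R -> R) (f : X -> X -> R) (eta : R -> R) :
  modulus_of_continuity eta ->
  (forall z x v, {homo (fun u => l z x u v) : a b /~ a <= b}) ->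
  (forall z x u, {homo (fun v => l z x u v) : a b /~ a <= b}) ->
  (forall z x s, `|l z x s s - l z x 0 0 - f z x * s| <= `|s| * eta `|s|) ->
  forall z x, f z x <= 0.
Proof.
move=> eta_mod l2u l2v lf z x; apply/ler_addgt0Pr => e e0; rewrite add0r.
have [r r0 re] := modulus_small eta_mod e0.
have := lf z x r; have := l2u z x 0 r 0 (ltW r0); have := l2v z x r r 0 (ltW r0).
rewrite /= (gtr0_norm r0) ler_norml => h1 h2 /andP[h3 _].
apply: (le_trans _ re); rewrite -(ler_pM2r r0) (mulrC (eta r)); lra.
Qed.

(** If [u x' < u x], a near minimiser [z] for [x'] is tested at [x]. As [l] is non-increasing in its
    last argument, [lam * u x] may be replaced there by [lam * u x'], so only the variation of [l]
    in [x] remains and the modulus depends on neither [u] nor [lam]. *)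
Lemma fixed_point_modulus (R : realType) (X : Type) (l : X -> X -> R -> R -> R)
    (lam M e : R) (u : X -> R) (x x' : X) : 0 <= lam ->
  (forall z y u, {homo (fun v => l z y u v) : a b /~ a <= b}) ->
  (forall z y, u y <= u z + l z y (lam * u z) (lam * u y)) ->
  (forall y e, 0 < e ->
    exists z, u z + l z y (lam * u z) (lam * u y) < u y + e) ->
  (forall y, `|lam * u y| <= M) ->
  (forall z a b, `|a| <= M -> `|b| <= M -> `|l z x a b - l z x' a b| <= e) ->
  `|u x - u x'| <= e.
Proof.
move=> lam0 l2v usub usup uM.
have half y y' : (forall z a b, `|a| <= M -> `|b| <= M ->
    `|l z y a b - l z y' a b| <= e) -> u y - u y' <= e.
  move=> le; have e0 : 0 <= e := le_trans (normr_ge0 _) (le y _ _ (uM y) (uM y)).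
  have [yy'|y'y] := leP (u y) (u y'); first by lra.
  apply/ler_addgt0Pr => d d0; have [z uz] := usup y' _ d0.
  have := le z _ _ (uM z) (uM y'); have := usub z y.
  have := l2v z y (lam * u z) _ _ (ler_wpM2l lam0 (ltW y'y)).
  by rewrite /= ler_norml; lra.
move=> le; rewrite ler_norml; have := half x x' le.
have : u x' - u x <= e by apply: half => z a b aM bM; rewrite distrC le.
lra.
Qed.

(* Shifting the critical solution [w] by [-A] makes the first order term
   [- lam A f] available; the corrector [phi] spreads its effect, which is only
   positive on average along the chains of small cost. For [lam] larger than
   [lam1] the solutions for [lam1] still work since they have a sign. *)
Lemma strict_solutions (R : realType) (X : Type) (l : X -> X -> R -> R -> R)
    (f : X -> X -> R) (eta : R -> R) (ku kv K d C W : R) (w phi : X -> R)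
    (x0 : X) :
  0 <= ku -> 0 <= kv ->
  (forall z x v, ku.-lipschitz (fun u => l z x u v)) ->
  (forall z x u, kv.-lipschitz (fun v => l z x u v)) ->
  (forall z x v, {homo (fun u => l z x u v) : a b /~ a <= b}) ->
  (forall z x u, {homo (fun v => l z x u v) : a b /~ a <= b}) ->
  modulus_of_continuity eta ->
  (forall z x s, `|l z x s s - l z x 0 0 - f z x * s| <= `|s| * eta `|s|) ->
  (forall x, `|w x| <= W) ->
  (forall y x, w x <= w y + l y x 0 0) ->
  (forall x, exists y, w x = w y + l y x 0 0) ->
  0 <= K -> 0 < d -> (forall x, - C <= phi x <= 0) ->
  (forall y x, d + phi x - phi y <= K * (l y x 0 0 + w y - w x) - f y x) ->
  exists M, forall lam, 0 < lam -> exists v V g, [/\ 0 < g,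
    forall x, - M <= v x <= 0, forall x, 0 <= V x <= M,
    forall z x, v x + g <= v z + l z x (lam * v z) (lam * v x) &
    forall x, exists z, V z + l z x (lam * V z) (lam * V x) + g <= V x].
Proof.
move=> ku0 kv0 l1u l1v l2u l2v eta_mod lf wW wl0 wl0E K0 d0 phiC gap.
have W0 : 0 <= W := le_trans (normr_ge0 _) (wW x0).
have C0 : 0 <= C by have := phiC x0; lra.
pose k := ku + kv; have k0 : 0 <= k by rewrite addr_ge0.
(* [A >= W + 1] gives [v] and [V] their signs; [A d >= 4 k (W + 1)] keeps the Lipschitz error
   [k mu (W + 1)] below a quarter of [s d]. *)
pose A := W + 1 + 4 * k * (W + 1) / d.
have kWd : 0 <= 4 * k * (W + 1) / d by rewrite divr_ge0 ?mulr_ge0//; lra.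
have A1 : W + 1 <= A by rewrite /A; lra.
have A0 : 0 < A by lra.
have Ad : 4 * k * (W + 1) <= A * d.
  have -> : A * d = (W + 1) * d + 4 * k * (W + 1) by rewrite /A; field; lra.
  by rewrite lerDr mulr_ge0//; lra.
have [r r0 re] : exists2 r, 0 < r & eta r <= d / 4.
  by apply: modulus_small => //; lra.
(* [r] controls the Taylor remainder. The other bound gives [s C <= 1], so that [s phi] stays in
   [[-1, 0]], and [s K <= 1], so that [s K L] is absorbed by [L]. *)
pose s1 := Num.min r (1 / (C + K + 1)).
have s10 : 0 < s1 by rewrite lt_min r0 divr_gt0//; lra.
have s1r : s1 <= r by rewrite ge_min lexx.
have s1CK : s1 * (C + K + 1) <= 1.
  by rewrite -ler_pdivlMr ?ge_min ?lexx ?orbT//; lra.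
exists (A + A) => lam lam0.
pose mu := Num.min lam (s1 / A); pose s := mu * A.
have mu0 : 0 < mu by rewrite lt_min lam0 divr_gt0.
have mulam : mu <= lam by rewrite ge_min lexx.
have s0 : 0 < s by rewrite mulr_gt0.
have ss1 : s <= s1 by rewrite /s -ler_pdivlMr// ge_min lexx orbT.
have sCK : s * (C + K + 1) <= 1.
  by apply: le_trans s1CK; rewrite ler_wpM2r//; lra.
have sC : s * C <= 1.
  by apply: le_trans sCK; rewrite ler_wpM2l ?(ltW s0)//; lra.
have sK : s * K <= 1.
  by apply: le_trans sCK; rewrite ler_wpM2l ?(ltW s0)//; lra.
have etas : s * eta s <= s * (d / 4).
  rewrite ler_wpM2l ?(ltW s0)//; apply: (le_trans _ re).
  have [_ eta_mono _ _] := eta_mod; apply: eta_mono; first exact: ltW.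
  exact: le_trans ss1 s1r.
have sphi x : - 1 <= s * phi x <= 0.
  have /andP[p1 p2] := phiC x; apply/andP; split.
    rewrite lerNl -mulrN (le_trans _ sC)// ?ler_wpM2l ?(ltW s0)//; lra.
  by rewrite mulr_ge0_le0// (ltW s0).
have muk : k * (mu * (W + 1)) <= s * (d / 4).
  have -> : s * (d / 4) = mu * (A * d) / 4 by rewrite /s; field.
  have -> : k * (mu * (W + 1)) = mu * (4 * k * (W + 1)) / 4 by field.
  by rewrite ler_wpM2r// ler_wpM2l// (ltW mu0).
have near_s z x a b c : `|a - c| <= W + 1 -> `|b - c| <= W + 1 ->
    `|l z x (mu * a) (mu * b) - l z x (mu * c) (mu * c)| <= s * (d / 4).
  move=> ac bc; apply: le_trans muk.
  have h1 := lipschitzE (l1u z x (mu * b)) (mu * a) (mu * c).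
  have h2 := lipschitzE (l1v z x (mu * c)) (mu * b) (mu * c).
  have scale p q (hpq : `|p - q| <= W + 1) t : 0 <= t ->
      t * `|mu * p - mu * q| <= t * (mu * (W + 1)).
    move=> t0; rewrite -mulrBr normrM (gtr0_norm mu0).
    by rewrite ler_wpM2l// ler_wpM2l// (ltW mu0).
  have := le_trans h1 (scale _ _ ac _ ku0).
  have := le_trans h2 (scale _ _ bc _ kv0).
  rewrite /k mulrDl; move: (ku * _) (kv * _) => p q; rewrite !ler_norml /=.
  by move=> /andP[? ?] /andP[? ?]; apply/andP; split; lra.
have taylor z x t : `|t| = s ->
    `|l z x t t - l z x 0 0 - f z x * t| <= s * (d / 4).
  by move=> ts; rewrite (le_trans (lf z x t))// ts.
have wW' x : - W <= w x <= W by rewrite -ler_norml.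
have muA : mu * A = s by [].
pose v x := w x - A + s * phi x; pose V x := w x + A - s * phi x.
(* The gap yields [s d], of which the Lipschitz and Taylor errors take a quarter each. *)
have g0 : 0 < s * (d / 2) by rewrite mulr_gt0//; lra.
exists v, V, (s * (d / 2)); split=> // [x|x|z x|x].
- by have := sphi x; have := wW' x; rewrite /v; lra.
- by have := sphi x; have := wW' x; rewrite /V; lra.
- have v_le0 y : v y <= 0 by have := sphi y; have := wW' y; rewrite /v; lra.
  (* As [v <= 0] and [mu <= lam], passing from [mu] to [lam] lowers the arguments of [l] and hence
     raises [l], so the estimate made at [mu] survives. *)
  have lamv y : lam * v y <= mu * v y by rewrite ler_wnM2r.
  have m1 := l2u z x (mu * v x) _ _ (lamv z).
  have m2 := l2v z x (lam * v z) _ _ (lamv x).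
  have := near_s z x (v z) (v x) (- A) _ _.
  have -> : `|v z - - A| <= W + 1.
    by have := sphi z; have := wW' z; rewrite /v ler_norml; lra.
  have -> : `|v x - - A| <= W + 1.
    by have := sphi x; have := wW' x; rewrite /v ler_norml; lra.
  move=> /(_ isT isT); rewrite mulrN muA => n1.
  have := taylor z x (- s); rewrite normrN gtr0_norm// => /(_ erefl) n2.
  have L0 : 0 <= l z x 0 0 + w z - w x by have := wl0 z x; lra.
  have sgap : s * (d + phi x - phi z) <=
      s * (K * (l z x 0 0 + w z - w x) - f z x).
    by rewrite ler_wpM2l// (ltW s0).
  have sKL : s * K * (l z x 0 0 + w z - w x) <= l z x 0 0 + w z - w x.
    by rewrite ler_piMl.
  move: m1 m2 n1 n2 sgap sKL; rewrite /= !ler_norml.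
  by rewrite /v => ? ? /andP[? ?] /andP[? ?] ? ?; lra.
(* At this [z] the reduced cost is 0, so the term in [K] disappears from the gap. *)
- have [z wz] := wl0E x; exists z.
  have V_ge0 y : 0 <= V y by have := sphi y; have := wW' y; rewrite /V; lra.
  have lamV y : mu * V y <= lam * V y by rewrite ler_wpM2r.
  have m1 := l2u z x (mu * V x) _ _ (lamV z).
  have m2 := l2v z x (lam * V z) _ _ (lamV x).
  have := near_s z x (V z) (V x) A _ _.
  have -> : `|V z - A| <= W + 1.
    by have := sphi z; have := wW' z; rewrite /V ler_norml; lra.
  have -> : `|V x - A| <= W + 1.
    by have := sphi x; have := wW' x; rewrite /V ler_norml; lra.
  move=> /(_ isT isT); rewrite muA => n1.
  have := taylor z x s; rewrite gtr0_norm// => /(_ erefl) n2.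
  have sgap : s * (d + phi x - phi z) <=
      s * (K * (l z x 0 0 + w z - w x) - f z x).
    by rewrite ler_wpM2l// (ltW s0).
  have L0 : l z x 0 0 + w z - w x = 0 by rewrite wz; ring.
  rewrite L0 mulr0 sub0r in sgap.
  move: m1 m2 n1 n2 sgap L0; rewrite /= !ler_norml /V.
  by move=> ? ? /andP[? ?] /andP[? ?] ? ?; lra.
Qed.

(** * Fixed points of the operator *)

Lemma is_Tlam_uniq (R : realType) (X : pmetricType R)
    (l : X -> X -> R -> R -> R) (lam : R) (phi psi psi' : continuousType X R) :
  0 <= lam -> (forall z x u, {homo (fun v => l z x u v) : a b /~ a <= b}) ->
  is_Tlam l lam phi psi -> is_Tlam l lam phi psi' -> psi = psi'.
Proof.
move=> lam0 l2v h h'; apply/continuousEP => x.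
wlog suff : psi psi' h h' / psi' x <= psi x.
  by move=> le; apply/le_anti; rewrite (le _ _ h h') (le _ _ h' h).
rewrite leNgt; apply/negP => lt.
(* The minimiser for the smaller value [psi x] is tested in the equation of [psi']; since [l] is
   non-increasing in [v], this gives [psi' x <= psi x]. *)
have [[z _ zE] _] := h x; have [_ lb] := h' x.
have := lb _ (ex_intro2 _ _ z I erefl).
have := l2v z x (lam * phi z) _ _ (ler_wpM2l lam0 (ltW lt)).
by rewrite /= => ? ?; lra.
Qed.

(* When no image of [u] exists [Tlam l lam u] is the default value, so that
   [u] vanishes. *)
Lemma Tlam_fixed (R : realType) (X : pmetricType R)
    (l : X -> X -> R -> R -> R) (lam : R) (u : continuousType X R) :
  Tlam l lam u = u -> is_Tlam l lam u u \/ forall x, u x = 0.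
Proof.
rewrite /Tlam; case: xgetP => [y yE Py yu|_ <-]; last by right.
by left; move: Py; rewrite /= yu.
Qed.

Lemma continuous_bounded (R : realType) (X : pmetricType R) (f : X -> R) :
  compact [set: X] -> continuous f -> exists M, forall x, `|f x| <= M.
Proof.
move=> cX cf.
have cnf : {within [set: X], continuous (fun x => `|f x|)}.
  by apply: continuous_subspaceT => x; apply: cvg_norm; exact: cf.
have [|x _ xmax] := compact_EVT_max _ cX cnf; first by exists point.
by exists `|f x| => y; apply: xmax; exact: mem_set.
Qed.

Theorem proposition3p1 (R : realType) (X : pmetricType R)
  (l : X -> X -> R -> R -> R) (ku kv lam0 : R) (eta : R -> R)
  (X_compact : compact [set: X])
  (l_cont : continuous
     (fun p : (X * X) * (R * R) => l p.1.1 p.1.2 p.2.1 p.2.2))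
  (ku_ge0 : 0 <= ku) (kv_ge0 : 0 <= kv)
  (l1u : forall z x v, ku.-lipschitz (fun u => l z x u v))
  (l1v : forall z x u, kv.-lipschitz (fun v => l z x u v))
  (l2u : forall z x v, {homo (fun u => l z x u v) : a b /~ a <= b})
  (l2v : forall z x u, {homo (fun v => l z x u v) : a b /~ a <= b})
  (eta_mod : modulus_of_continuity eta)
  (l3u : forall z x, derivable (fun u => l z x u 0) 0 1)
  (l3v : forall z x, derivable (fun v => l z x 0 v) 0 1)
  (l3 : forall z x u v,
     `|l z x u v - l z x 0 0 - du0 l z x * u - dv0 l z x * v|
       <= (`|u| + `|v|) / 2 * eta ((`|u| + `|v|) / 2))
  (l4 : forall mu : probability (g_sigma_algebraType (@open (X * X)%type)) R,
     Mather_measure (fun z x => l z x 0 0) 0 mu ->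
     (\int[mu]_p (du0 l p.1 p.2 + dv0 l p.1 p.2)%:E < 0)%E)
  (critical0 : critical_constant (fun z x => l z x 0 0) 0)
  (lam0_gt0 : 0 < lam0) (lam0_lt : lam0 * Num.max ku kv < 1) :
  [/\ forall lam, 0 < lam < lam0 ->
        exists u : continuousType X R, Tlam l lam u = u,
      exists M : R, forall u, fixed_points l lam0 u -> forall x, `|u x| <= M &
      equicontinuous (fixed_points l lam0)
        (fun u : continuousType X R => (u : X -> R))].
Proof.
have [w hw] := critical0.
have wl0 y x : w x <= w y + l y x 0 0.
  have [m [_ lb] ->] := hw x; rewrite addr0; apply: lb; by exists y.
have wl0E x : exists y, w x = w y + l y x 0 0.
  by have [m [[y _ ym] _] ->] := hw x; exists y; rewrite addr0 -ym.
have [W wW] := continuous_bounded X_compact (@cts_fun _ _ w).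
pose f z x := du0 l z x + dv0 l z x.
have lf : forall z x s, `|l z x s s - l z x 0 0 - f z x * s| <= `|s| * eta `|s|.
  exact: cost_Taylor l3.
have cf := cost_slope_continuous l_cont eta_mod lf.
have f_le0 := cost_slope_le0 eta_mod l2u l2v lf.
have cl0 := cost_diagonal_continuous (s := 0) l_cont.
have [K [d [C [phi [K0 d0 phiC gap]]]]] :=
  Mather_gap X_compact cl0 cf wW wl0 f_le0 l4.
have [M HM] := strict_solutions point ku_ge0 kv_ge0 l1u l1v l2u l2v eta_mod lf
  wW wl0 wl0E K0 d0 phiC gap.
have M0 : 0 <= M.
  have [v [V [g [_ _ VM _ _]]]] := HM 1 ltr01.
  by have /andP[] := VM point; exact: le_trans.
pose G lam z x a b := a + l z x (lam * a) (lam * b).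
have lamku lam : 0 < lam < lam0 -> lam * ku <= 1.
  move=> /andP[lam_gt0 lam_lt].
  have : lam * ku <= lam0 * Num.max ku kv.
    by apply: ler_pM => //; [exact: ltW|exact: ltW|rewrite le_max lexx].
  by move=> /le_trans; apply; exact: ltW.
(* [l] is evaluated at [lam * a] with [lam * ku <= 1], so it cannot decrease faster than [a]
   increases. *)
have Gl lam : 0 < lam < lam0 -> forall z x a a' b, a <= a' ->
    G lam z x a b <= G lam z x a' b.
  move=> hlam z x a a' b aa'; have /andP[lam_gt0 _] := hlam.
  have := lipschitzE (l1u z x (lam * b)) (lam * a) (lam * a').
  have -> : `|lam * a - lam * a'| = lam * (a' - a).
    by rewrite -mulrBr normrM (gtr0_norm lam_gt0) distrC ger0_norm ?subr_ge0.
  have : ku * (lam * (a' - a)) <= a' - a.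
    by rewrite mulrA ler_piMl ?subr_ge0// mulrC lamku.
  by rewrite ler_norml /G /=; lra.
have Gr lam : 0 < lam < lam0 -> forall z x a b b', b <= b' ->
    G lam z x a b' <= G lam z x a b.
  move=> /andP[lam_gt0 _] z x a b b' bb'.
  by rewrite lerD2l; apply: l2v; rewrite ler_pM2l.
have Gs lam : 0 < lam < lam0 -> forall z x a a' b, a <= a' ->
    G lam z x a' b <= G lam z x a b + (a' - a).
  move=> /andP[lam_gt0 _] z x a a' b aa'.
  have := l2u z x (lam * b) (lam * a') (lam * a).
  by rewrite /= ler_pM2l// => /(_ aa'); rewrite /G; lra.
have GL lam : 0 < lam < lam0 -> forall z x a b b',
    `|G lam z x a b - G lam z x a b'| <= (kv * lam) * `|b - b'|.
  move=> /andP[lam_gt0 _] z x a b b'; rewrite /G opprD addrACA subrr add0r.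
  rewrite (le_trans (lipschitzE (l1v z x _) _ _))//.
  by rewrite -mulrBr normrM (gtr0_norm lam_gt0) mulrA.
have bound lam (u : continuousType X R) : 0 < lam < lam0 ->
    is_Tlam l lam u u -> forall x, `|u x| <= M.
  move=> hlam uT; have /andP[lam_gt0 _] := hlam.
  have [v [V [g [g0 vM VM vsub Vsup]]]] := HM lam lam_gt0.
  (* [N] depends on [u] but only starts the descent; the bound obtained is [M]. *)
  have [N uN] := continuous_bounded X_compact (@cts_fun _ _ u).
  have uN' x : - N <= u x <= N by rewrite -ler_norml.
  have usub z x : u x <= G lam z x (u z) (u x).
    by have [_] := uT x; apply; exists z.
  have usup x : exists z, G lam z x (u z) (u x) <= u x.
    by have [[z _ zx] _] := uT x; exists z; rewrite /G zx.
  have vu : forall x, v x <= u x.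
    apply: (strict_subsolution_le (t := N) g0 (Gl _ hlam) (Gr _ hlam)
      (Gs _ hlam)) => //.
    by move=> x; have := vM x; have := uN' x; lra.
  have uV : forall x, u x <= V x.
    apply: (strict_supersolution_ge (t := N) g0 (Gl _ hlam) (Gr _ hlam)
      (Gs _ hlam)) => //.
    by move=> x; have := VM x; have := uN' x; lra.
  by move=> x; have := vu x; have := uV x; have := vM x; have := VM x;
    rewrite ler_norml; lra.
(* The neighbourhood of [x] is chosen before [lam] and [u], through [|lam * u y| <= lam0 * M]. This
   gives equicontinuity, and also the continuity of the function produced by Perron's method. *)
have modulus x e : 0 < e -> \forall x' \near x, forall lam (u : X -> R),
    0 < lam < lam0 -> (forall y, `|u y| <= M) ->
    (forall z y, u y <= G lam z y (u z) (u y)) ->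
    (forall y e, 0 < e -> exists z, G lam z y (u z) (u y) < u y + e) ->
    `|u x - u x'| <= e.
  move=> e0; have := cost_equicontinuous (lam0 * M) x X_compact l_cont e0.
  apply: filterS => x' hx' lam u /andP[lam_gt0 lam_lt] uM usub usup.
  apply: (fixed_point_modulus (ltW lam_gt0) l2v usub usup _ hx') => y.
  rewrite normrM (gtr0_norm lam_gt0).
  by apply: ler_pM => //; exact: ltW.
split.
- move=> lam hlam; have /andP[lam_gt0 _] := hlam.
  have [v [V [g [g0 vM VM vsub Vsup]]]] := HM lam lam_gt0.
  have kl : 0 <= kv * lam by rewrite mulr_ge0// ltW.
  have [|||u [uvV usub usup]] :=
    @Perron _ _ (G lam) _ v V kl (Gl _ hlam) (Gr _ hlam) (GL _ hlam).
  + by move=> x; have := vM x; have := VM x; lra.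
  + by move=> z x; have := vsub z x; rewrite /G; lra.
  + by move=> x; have [z zV] := Vsup x; exists z; move: zV; rewrite /G; lra.
  have uM x : `|u x| <= M.
    by have := uvV x; have := vM x; have := VM x; rewrite ler_norml; lra.
  have cu : continuous u.
    move=> x; apply/cvgrPdist_le => e e0; have := modulus x e e0.
    by apply: filterS => x' /(_ lam u hlam uM usub usup).
  pose U : continuousType X R := mkcts cu.
  have UT : is_Tlam l lam U U.
    move=> x.
    have cG : {within [set: X], continuous (fun z => G lam z x (u z) (u x))}.
      apply: continuous_subspaceT => z; apply: cvgD; first exact: cu.
      apply: (@cvg_comp _ _ _ (fun z => ((z, x), (lam * u z, lam * u x)))
        _ _ (nbhs ((z, x), (lam * u z, lam * u x))) _ _
        (l_cont ((z, x), (lam * u z, lam * u x)))).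
      apply: (@cvg_pair _ _ _ _ (nbhs (z, x)) (nbhs (lam * u z, lam * u x))).
        apply: (@cvg_pair _ _ _ _ (nbhs z) (nbhs x)); first exact: cvg_id.
        exact: cvg_cst.
      apply: (@cvg_pair _ _ _ _ (nbhs (lam * u z)) (nbhs (lam * u x))).
        by apply: cvgMl_tmp; exact: cu.
      exact: cvg_cst.
    (* Perron's method yields near minimisers only; continuity of [u] and compactness of [X] turn
       them into a minimiser. *)
    have [|z _ zmin] := compact_EVT_min _ X_compact cG; first by exists point.
    have uz : u x = G lam z x (u z) (u x).
      apply/le_anti; rewrite usub/=; apply/ler_addgt0Pr => e e0.
      have [y /ltW yu] := usup x e e0.
      by rewrite (le_trans (zmin y _))// mem_set.
    split; first by exists z.
    by move=> _ [y _ <-]; exact: usub.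
  exists U; rewrite /Tlam; apply: (is_Tlam_uniq (ltW lam_gt0) l2v _ UT).
  by apply: (@xgetPex _ _ [set psi | is_Tlam l lam U psi]); exists U.
(* If [Tlam] returns its default value, the fixed point is the zero function, which satisfies the
   bound here and the modulus below. *)
- exists M => u [lam hlam /Tlam_fixed[uT|u0] x].
    exact: (bound _ _ hlam uT x).
  by rewrite u0 normr0.
- move=> x E; rewrite -entourage_ballE => -[e /= e0 eE].
  have e2 : 0 < e / 2 by lra.
  have := modulus x _ e2; apply: filterS => x' hx' u [lam hlam uT].
  apply: eE => /=; rewrite /ball/=.
  case/Tlam_fixed: uT => [uT|u0]; last by rewrite !u0 subrr normr0.
  suff : `|u x - u x'| <= e / 2 by lra.
  apply: (hx' _ _ hlam) => [y|z y|y s s0].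
    exact: (bound _ _ hlam uT y).
    by have [_] := uT y; apply; exists z.
  by have [[z _ zy] _] := uT y; exists z; rewrite /G zy ltrDl.
Qed.
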